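(* Let $(\pi,\hat\pi)\in\mathbb{R}^{n}\times\mathbb{R}$ with $\hat\pi\ne0$ ($\pi=0$ is allowed), let $\pi_0<\pi_1$ be real, and let $F=\{(x,t)\in\mathbb{R}^{n+1}:\pi_0\le\pi^Tx+\hat\pi t\le\pi_1\}$. Let $Q_0=\{(x,t)\in\mathbb{R}^{n+1}:\|x\|_2^2\le t\}$ and $\overline{Q_0}=\mathrm{conv}(Q_0\setminus \mathrm{int}(F))$. (1) If $\hat\pi>0$ and $\pi_1\le\frac{-\|\pi\|_2^2}{4\hat\pi}$, or if $\hat\pi<0$ and $\frac{-\|\pi\|_2^2}{4\hat\pi}\le\pi_0$, then $\overline{Q_0}=Q_0$. (2) If $\hat\pi>0$ and $\pi_0<\frac{-\|\pi\|_2^2}{4\hat\pi}<\pi_1$, then $\overline{Q_0}=\{(x,t)\in Q_0:\pi^Tx+\hat\pi t\ge\pi_1\}$. (3) If $\hat\pi<0$ and $\pi_0<\frac{-\|\pi\|_2^2}{4\hat\pi}<\pi_1$, then $\overline{Q_0}=\{(x,t)\in Q_0:\pi^Tx+\hat\pi t\le\pi_0\}$. (4) If $\hat\pi>0$ and $\frac{-\|\pi\|_2^2}{4\hat\pi}\le\pi_0$, or if $\hat\pi<0$ and $\pi_1\le\frac{-\|\pi\|_2^2}{4\hat\pi}$, then $\overline{Q_0}=Q_0\cap C$, where $$C=\Bigl\{(x,t)\in\mathbb{R}^{n+1}:\Bigl\|P_\pi^\perp x+\frac{\pi^Tx+b}{\|\pi\|_2^2}\pi\Bigr\|_2\le c\,\pi^Tx+d\,t+e\Bigr\},$$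 with $$f=\sqrt{\|\pi\|_2^2+2(\pi_0+\pi_1)\hat\pi-\sqrt{\|\pi\|_2^2+4\pi_0\hat\pi}\,\sqrt{\|\pi\|_2^2+4\pi_1\hat\pi}},$$ $$b=\frac{\|\pi\|_2^2}{2\hat\pi},\quad c=\frac{f}{\sqrt2(\pi_1-\pi_0)\hat\pi},\quad d=c\hat\pi,\quad e=\frac{\|\pi\|_2^2+\sqrt{\|\pi\|_2^2+4\pi_0\hat\pi}\,\sqrt{\|\pi\|_2^2+4\pi_1\hat\pi}}{4\sqrt2(\pi_1-\pi_0)\hat\pi^2}\,f.$$
   Context: $P_\pi^\perp=I-\frac{\pi\pi^T}{\|\pi\|_2^2}$. When $\pi=0$ the convention $0/0:=0$ is used, so that $P_\pi^\perp=I$ and the term $\frac{\pi^Tx+b}{\|\pi\|_2^2}\pi$ is $0$. $\mathrm{int}$ is the topological interior and $\mathrm{conv}$ the convex hull. *)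

(* Defs.v *)
From HB Require Import structures.
From mathcomp Require Import all_boot all_order all_algebra.
From mathcomp Require Import all_classical reals topology normedtype convex.

Set Implicit Arguments.
Unset Strict Implicit.
Unset Printing Implicit Defensive.

Import Order.TTheory GRing.Theory Num.Theory.
Import numFieldNormedType.Exports.

Local Open Scope classical_set_scope.
Local Open Scope ring_scope.

(* R^n is 'cV[R]_n, and R^(n+1) is the product 'cV[R]_n * R^o with the product
   topology. R^o is R seen as a module over itself, which the lmodType structure
   of the product requires. Throughout, p : 'cV[R]_n is pi, ph : R is pi-hat, and
   p0 < p1 are pi_0 < pi_1. *)

Definition dot (R : realType) (n : nat) (u v : 'cV[R]_n) : R := (u^T *m v) 0 0.

(* The norm `|x| of the library on 'cV[R]_n is the sup norm, not this one. *)
Definition norm2 (R : realType) (n : nat) (x : 'cV[R]_n) : R :=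
  Num.sqrt (\sum_i x i 0 ^+ 2).

Definition convex_hull (R : realType) (V : lmodType R) (A : set V) : set V :=
  smallest (@convex_set R V) A.

Definition split_set (R : realType) (n : nat) (p : 'cV[R]_n) (ph p0 p1 : R) :
    set ('cV[R]_n * R^o) :=
  [set z | p0 <= dot p z.1 + ph * z.2 <= p1].

Definition paraboloid (R : realType) (n : nat) : set ('cV[R]_n * R^o) :=
  [set z | norm2 z.1 ^+ 2 <= z.2].

Definition paraboloid_hull (R : realType) (n : nat)
    (p : 'cV[R]_n) (ph p0 p1 : R) : set ('cV[R]_n * R^o) :=
  convex_hull (@paraboloid R n `\` (split_set p ph p0 p1)°).

(* Division by 0 is 0 in the library: for p = 0 the projection is the identity,
   and the term along p in the cut is 0. *)
Definition proj_orth (R : realType) (n : nat) (p : 'cV[R]_n) : 'M[R]_n :=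
  1%:M - (norm2 p ^+ 2)^-1 *: (p *m p^T).

Section cut_coefficients.
Variables (R : realType) (n : nat) (p : 'cV[R]_n) (ph p0 p1 : R).

Definition sqrt_prod : R :=
  Num.sqrt (norm2 p ^+ 2 + 4 * p0 * ph) * Num.sqrt (norm2 p ^+ 2 + 4 * p1 * ph).

Definition cut_f : R :=
  Num.sqrt (norm2 p ^+ 2 + 2 * (p0 + p1) * ph - sqrt_prod).

Definition cut_b : R := norm2 p ^+ 2 / (2 * ph).

Definition cut_c : R := cut_f / (Num.sqrt 2 * (p1 - p0) * ph).

Definition cut_d : R := cut_c * ph.

Definition cut_e : R :=
  (norm2 p ^+ 2 + sqrt_prod) / (4 * Num.sqrt 2 * (p1 - p0) * ph ^+ 2) * cut_f.

Definition cut_set : set ('cV[R]_n * R^o) :=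
  [set z | norm2 (proj_orth p *m z.1 +
                  ((dot p z.1 + cut_b) / norm2 p ^+ 2) *: p)
           <= cut_c * dot p z.1 + cut_d * z.2 + cut_e].

End cut_coefficients.

(* Main.v *)
(* Completing the square: with q = pi / (2 pi-hat), the affine bijection
   (x, t) |-> (x + q, t + 2 q.x + |q|^2) preserves the paraboloid |x|^2 <= t and
   turns pi.x + pi-hat t into an affine function of the last coordinate alone.
   So it suffices to treat a horizontal slab l < t < h. If h <= 0 it contains no
   point of the paraboloid; if l < 0 only the convex part t >= h is left; if
   0 <= l, a point (y, t) of the slab with |y| <= r, where r is the height at t
   of the chord of the square root from l to h, is a convex combination of
   (sqrt l / r y, l) and (sqrt h / r y, h). *)
Require Import Defs.
From mathcomp Require Import all_boot all_order all_algebra.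
From mathcomp Require Import all_classical reals topology normedtype convex.
From mathcomp Require Import interval_inference ring lra.
Import Order.TTheory GRing.Theory Num.Theory.
Import numFieldNormedType.Exports.
Local Open Scope classical_set_scope.
Local Open Scope ring_scope.

(** * Euclidean inner product and norm on column vectors *)

Section Euclidean.
Context {R : realType} {n : nat}.
Implicit Types u v w : 'cV[R]_n.

Lemma dotE u v : dot u v = \sum_i u i 0 * v i 0.
Proof. by rewrite /dot mxE; apply: eq_bigr => i _; rewrite mxE. Qed.

Lemma dotC u v : dot u v = dot v u.
Proof. by rewrite !dotE; apply: eq_bigr => i _; rewrite mulrC. Qed.

Lemma dotDl u v w : dot (u + v) w = dot u w + dot v w.
Proof. by rewrite /dot linearD mulmxDl mxE. Qed.

Lemma dotZl a u v : dot (a *: u) v = a * dot u v.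
Proof. by rewrite /dot linearZ -scalemxAl mxE. Qed.

Lemma dotDr u v w : dot u (v + w) = dot u v + dot u w.
Proof. by rewrite dotC dotDl !(dotC u). Qed.

Lemma dotZr a u v : dot u (a *: v) = a * dot u v.
Proof. by rewrite dotC dotZl dotC. Qed.

Lemma dot0l u : dot 0 u = 0.
Proof. by rewrite -(scale0r u) dotZl mul0r. Qed.

Definition dot_linear := (dotDl, dotDr, dotZl, dotZr).

Lemma dot_ge0 u : 0 <= dot u u.
Proof. by rewrite dotE; apply: sumr_ge0 => i _; rewrite -expr2 sqr_ge0. Qed.

Lemma dot_eq0 u : dot u u = 0 -> u = 0.
Proof.
rewrite dotE => /eqP; rewrite psumr_eq0 => [/allP u0|i _]; last first.
  by rewrite -expr2 sqr_ge0.
apply/colP => i; rewrite mxE; apply/eqP; rewrite -[_ == 0]orbb -mulf_eq0.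
exact: u0 (mem_index_enum i).
Qed.

Lemma norm2E u : norm2 u = Num.sqrt (dot u u).
Proof. by rewrite /norm2 dotE; congr Num.sqrt; apply: eq_bigr. Qed.

Lemma norm2_ge0 u : 0 <= norm2 u.
Proof. exact: sqrtr_ge0. Qed.

Lemma norm2_sqr u : norm2 u ^+ 2 = dot u u.
Proof. by rewrite norm2E sqr_sqrtr ?dot_ge0. Qed.

Lemma norm2Z a u : norm2 (a *: u) = `|a| * norm2 u.
Proof.
by rewrite !norm2E dotZl dotZr mulrA -expr2 sqrtrM ?sqr_ge0 // sqrtr_sqr.
Qed.

(** For nonzero vectors, expanding the squared norm of |v| u - |u| v gives 2 |u| |v| (|u| |v| - u.v)
    >= 0, and the positive factor |u| |v| can be cancelled. *)
Lemma cauchy_schwarz u v : dot u v <= norm2 u * norm2 v.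
Proof.
have [/dot_eq0 ->|] := eqVneq (dot u u) 0.
  by rewrite dot0l mulr_ge0 ?norm2_ge0.
have [/dot_eq0 ->|] := eqVneq (dot v v) 0.
  by rewrite dotC dot0l mulr_ge0 ?norm2_ge0.
rewrite -!norm2_sqr !sqrf_eq0 => v0 u0.
have ab0 : 0 < norm2 u * norm2 v.
  by rewrite mulr_gt0 // lt_neqAle norm2_ge0 eq_sym ?u0 ?v0.
rewrite -(ler_pM2l ab0); have := dot_ge0 (norm2 v *: u + (- norm2 u) *: v).
rewrite !dot_linear (dotC v u) -!norm2_sqr; lra.
Qed.

Lemma ler_norm2D u v : norm2 (u + v) <= norm2 u + norm2 v.
Proof.
rewrite -ler_sqr ?nnegrE ?addr_ge0 ?norm2_ge0 // norm2_sqr !dot_linear.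
rewrite (dotC v u) -!norm2_sqr; have := cauchy_schwarz u v; lra.
Qed.

Lemma paraboloidE (z : 'cV[R]_n * R^o) : paraboloid z = (dot z.1 z.1 <= z.2).
Proof. by rewrite /paraboloid /= norm2_sqr. Qed.

End Euclidean.

(** * Convex hulls and their transport along affine bijections *)

Section ConvexHull.
Context {R : realType}.

(** Unpacks the library's convexity, whose weights are bundled with their bounds, into plain real
    weights. *)
Lemma convex_setP {V : lmodType R} (A : set V) :
  @convex_set R V A <-> forall k x y, 0 <= k <= 1 -> A x -> A y ->
    A (k *: x + (1 - k) *: y).
Proof.
split=> [cA k x y /andP[k0 k1] /mem_set Ax /mem_set Ay|cA x y k].
  have /cA/(_ Ay) := Ax.
  by move=> /(_ (Itv01 k0 k1)) /set_mem.
move=> /set_mem Ax /set_mem Ay; apply/mem_set/cA => //.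
by rewrite ge0 le1.
Qed.

Lemma convex_hull_id {V : lmodType R} (A : set V) :
  @convex_set R V A -> convex_hull A = A.
Proof. by move=> cA; apply: smallest_id. Qed.

Lemma sub_convex_hull {V : lmodType R} (A : set V) : A `<=` convex_hull A.
Proof. exact: sub_gen_smallest. Qed.

Lemma convex_convex_hull {V : lmodType R} (A : set V) :
  @convex_set R V (convex_hull A).
Proof.
apply/convex_setP => k x y k01 Ax Ay B [cB AB].
by apply: (proj1 (convex_setP B) cB) => //; [apply: (Ax B)|apply: (Ay B)].
Qed.

Lemma convex_hull_eq {V : lmodType R} (A B : set V) :
  @convex_set R V B -> A `<=` B -> B `<=` convex_hull A -> convex_hull A = B.
Proof. by move=> cB AB BA; apply/seteqP; split=> //; apply: smallest_sub. Qed.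

Definition affine_map {V W : lmodType R} (g : V -> W) :=
  forall k x y, g (k *: x + (1 - k) *: y) = k *: g x + (1 - k) *: g y.

Lemma convex_set_preimage {V W : lmodType R} (g : V -> W) (A : set W) :
  affine_map g -> @convex_set R W A -> @convex_set R V (g @^-1` A).
Proof.
move=> gA /convex_setP cA; apply/convex_setP => k x y k01 Ax Ay.
by rewrite /= gA; apply: cA.
Qed.

(** Preimages of convex sets under affine maps are convex. Applied to [g], this bounds the left
    hull; applied to [g'], it turns each convex set containing the preimage of [A] into one
    containing [A], which gives the other inclusion. *)
Lemma convex_hull_preimage {V W : lmodType R} (g : V -> W) (g' : W -> V)
    (A : set W) :
  affine_map g -> affine_map g' -> cancel g g' -> cancel g' g ->
  convex_hull (g @^-1` A) = g @^-1` convex_hull A.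
Proof.
move=> ag ag' gK g'K; apply: convex_hull_eq.
- exact/convex_set_preimage/convex_convex_hull.
- by move=> z; apply: (@sub_convex_hull _ A).
- move=> z Az B [cB AB]; rewrite -(gK z).
  apply: (Az (g' @^-1` B)); split; first exact: convex_set_preimage.
  by move=> w Aw; apply: AB; rewrite /= g'K.
Qed.

End ConvexHull.

(** * Hulls of the paraboloid minus a horizontal slab, and the shear preserving it *)

Section Paraboloid.
Context {R : realType} {n : nat}.
Local Notation V := ('cV[R]_n * R^o)%type.

(** The convexity gap of the squared norm is k (1 - k) |x - y|^2. *)
Lemma convex_paraboloid : @convex_set R V (@paraboloid R n).
Proof.
apply/convex_setP => k x y /andP[k0 k1]; rewrite !paraboloidE => Px Py.
rewrite /= !dot_linear (dotC y.1 x.1) /GRing.scale /=.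
have := dot_ge0 (x.1 + (-1) *: y.1); rewrite !dot_linear (dotC y.1 x.1).
have k1' : 0 <= 1 - k by rewrite subr_ge0.
move=> /(mulr_ge0 (mulr_ge0 k0 k1')).
have := ler_wpM2l k0 Px; have := ler_wpM2l k1' Py.
lra.
Qed.

Definition outer (l h : R) : set V :=
  [set z | paraboloid z /\ (z.2 <= l \/ h <= z.2)].

Lemma hull_outer_le0 (l h : R) : h <= 0 ->
  convex_hull (outer l h) = @paraboloid R n.
Proof.
move=> h0; rewrite -(convex_hull_id _ convex_paraboloid); congr convex_hull.
apply/seteqP; split=> [z []|z Pz] //; split=> //; right.
by move: Pz; rewrite paraboloidE => /(le_trans (dot_ge0 _))/(le_trans h0).
Qed.

Lemma hull_outer_straddle (l h : R) : l < 0 ->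
  convex_hull (outer l h) = [set z | paraboloid z /\ h <= z.2].
Proof.
move=> l0; have -> : outer l h = [set z | paraboloid z /\ h <= z.2].
  apply/seteqP; split=> z [Pz]; last by split=> //; right.
  case=> // zl; split=> //; move: Pz; rewrite paraboloidE.
  by move=> /(le_trans (dot_ge0 _))/le_trans/(_ zl); rewrite leNgt l0.
apply: convex_hull_id; apply/convex_setP => k x y k01 [Px hx] [Py hy].
split; first by move/convex_setP: convex_paraboloid; apply.
move: k01 => /andP[k0 k1]; rewrite /= /GRing.scale /=.
have k1' : 0 <= 1 - k by rewrite subr_ge0.
have := ler_wpM2l k0 hx; have := ler_wpM2l k1' hy; lra.
Qed.

(* [(t + a b) / (a + b)] is the chord of the square root from [a ^+ 2] to
   [b ^+ 2]. *)
Lemma hull_outer_chord (a b : R) : 0 <= a -> a < b ->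
  convex_hull (outer (a ^+ 2) (b ^+ 2)) =
  @paraboloid R n `&` [set z | norm2 z.1 <= (z.2 + a * b) / (a + b)].
Proof.
move=> a0 ab; have b0 : 0 < b by apply: le_lt_trans ab.
have s0 : 0 < a + b by rewrite ltr_wpDl.
apply: convex_hull_eq.
- apply/convex_setP => k x y k01 [Px Cx] [Py Cy].
  split; first by move/convex_setP: convex_paraboloid; apply.
  move: k01 Cx Cy => /andP[k0 k1] /= Cx Cy; apply: le_trans (ler_norm2D _ _) _.
  have k1' : 0 <= 1 - k by rewrite subr_ge0.
  rewrite !norm2Z !ger0_norm // /GRing.scale /=.
  move: Cx Cy; rewrite !ler_pdivlMr //.
  move=> /(ler_wpM2l k0) + /(ler_wpM2l k1'); lra.
- move=> z [Pz out]; split=> //=; rewrite ler_pdivlMr //.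
  have := Pz; rewrite /paraboloid /= => Nt.
  have t0 : 0 <= z.2 by apply: le_trans Nt; rewrite sqr_ge0.
  have Ns : norm2 z.1 <= Num.sqrt z.2.
    by rewrite -(ger0_norm (norm2_ge0 z.1)) -sqrtr_sqr ler_wsqrtr.
  have : norm2 z.1 * (a + b) <= Num.sqrt z.2 * (a + b) by rewrite ler_pM2r.
  move/le_trans; apply; rewrite -{2}(sqr_sqrtr t0).
  (* With s the root of t, the bound s (a + b) <= s^2 + a b is exactly this product inequality;
     outside the slab s is not strictly between a and b. *)
  suff : 0 <= (Num.sqrt z.2 - a) * (Num.sqrt z.2 - b) by lra.
  case: out => zo.
    have : Num.sqrt z.2 <= a by rewrite -(ger0_norm a0) -sqrtr_sqr ler_wsqrtr.
    by move=> ?; apply: mulr_le0; lra.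
  have : b <= Num.sqrt z.2.
    by rewrite -(ger0_norm (ltW b0)) -sqrtr_sqr ler_wsqrtr.
  by move=> ?; apply: mulr_ge0; lra.
move=> [y t] [Pz /= Cz].
have [ta|ta] := leP t (a ^+ 2).
  by apply: sub_convex_hull; split=> //; left.
have [tb|tb] := leP (b ^+ 2) t.
  by apply: sub_convex_hull; split=> //; right.
set r : R := (t + a * b) / (a + b) in Cz.
(* Strict even when a = 0, because t > a^2 here; this permits the division by r below. *)
have r0 : 0 < r.
  apply: divr_gt0 => //; apply: ltr_wpDr; first exact: mulr_ge0 (ltW b0).
  by apply: le_lt_trans ta; rewrite sqr_ge0.
have rE : r * (a + b) = t + a * b by rewrite divfK ?gt_eqF.
have arb : a <= r <= b.
  rewrite ler_pdivlMr // ler_pdivrMr //; apply/andP; split; lra.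
(* The weight that writes r as a mean of a and b. Since (r, t) lies on the line through (a, a^2) and
   (b, b^2), the same weight recovers t. *)
set k := (b - r) / (b - a).
have ba0 : 0 < b - a by rewrite subr_gt0.
have k01 : 0 <= k <= 1.
  by rewrite divr_ge0 ?ler_pdivrMr //; lra.
have kE : k * a + (1 - k) * b = r by rewrite /k; field; rewrite gt_eqF.
have tE : t = k * a ^+ 2 + (1 - k) * b ^+ 2.
  have -> : t = r * (a + b) - a * b by rewrite rE; ring.
  by rewrite -kE; ring.
(* Rescaling y by c / r brings its norm to at most c, because |y| <= r. *)
have side c : 0 <= c -> paraboloid ((c / r) *: y, c ^+ 2 : R^o).
  move=> c0; rewrite /paraboloid /= norm2Z.
  have cr0 : 0 <= c / r := divr_ge0 c0 (ltW r0).
  rewrite (ger0_norm cr0) ler_sqr ?nnegrE ?(mulr_ge0 cr0) ?norm2_ge0 //.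
  by rewrite mulrAC ler_pdivrMr // ler_wpM2l.
have ytE : ((y, t) : V) = k *: (((a / r) *: y, a ^+ 2) : V)
               + (1 - k) *: (((b / r) *: y, b ^+ 2) : V).
  congr (_, _) => //=; rewrite !scalerA -scalerDl !mulrA -mulrDl kE.
  by rewrite divff ?scale1r // gt_eqF.
have hull_side : forall c, 0 <= c -> c ^+ 2 <= a ^+ 2 \/ b ^+ 2 <= c ^+ 2 ->
    convex_hull (outer (a ^+ 2) (b ^+ 2)) ((c / r) *: y, c ^+ 2 : R^o).
  by move=> c c0 cab; apply: sub_convex_hull; split; first exact: side.
have := proj1 (convex_setP _) (convex_convex_hull _) _ _ _ k01
  (hull_side a a0 (or_introl (lexx _))) (hull_side b (ltW b0) (or_intror (lexx _))).
by rewrite -ytE.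
Qed.

(** The last coordinate grows by |x + q|^2 - |x|^2, so t - |x|^2 is unchanged. The inverse is the
    shear by -q. *)
Definition shear (q : 'cV[R]_n) (z : V) : V :=
  (z.1 + q, z.2 + 2 * dot q z.1 + dot q q).

Lemma shear_affine q : affine_map (shear q).
Proof.
move=> k x y; congr (_, _) => /=.
  rewrite !scalerDr addrACA -scalerDl addrCA subrr addr0 scale1r //.
rewrite !dot_linear /GRing.scale /=; ring.
Qed.

Lemma shearK q : cancel (shear q) (shear (- q)).
Proof.
move=> [x t]; congr (_, _) => /=; first by rewrite addrK.
rewrite -scaleN1r !dot_linear; ring.
Qed.

Lemma shear_paraboloid q : shear q @^-1` @paraboloid R n = @paraboloid R n.
Proof.
apply/seteqP; split=> z; rewrite /= !paraboloidE /= !dot_linear (dotC q);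
  lra.
Qed.

Lemma convex_hull_shear q (A : set V) :
  convex_hull (shear q @^-1` A) = shear q @^-1` convex_hull A.
Proof.
apply: (@convex_hull_preimage _ _ _ _ (shear (- q))); try exact: shear_affine.
  exact: shearK.
by rewrite -{2}(opprK q); apply: shearK.
Qed.

End Paraboloid.

(** * Topological interior of the split *)

Section Split.
Context {R : realType} {n : nat} (p : 'cV[R]_n) (ph p0 p1 : R).
Hypothesis hph : ph != 0.
Local Notation V := ('cV[R]_n * R^o)%type.

Lemma split_continuous : continuous (fun z : V => dot p z.1 + ph * z.2 : R).
Proof.
have dot_continuous : continuous (dot p).
  rewrite (funext (dotE p)).
  apply: (@continuous_big R^o _ +%R) => [|i _ x]; first exact: add_continuous.
  apply: (@cvgMr R _ _ (nbhs_filter x)); exact: coord_continuous.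
move=> z; apply: (@cvgD R R^o).
  apply: (@cvg_comp _ _ _ fst (dot p) _ _ _ _ (dot_continuous z.1)).
  exact: cvg_fst.
apply: (@cvgMr R _ _ (nbhs_filter z)); exact: cvg_snd.
Qed.

(** The strict strip is open by continuity. Conversely, as [ph] is nonzero, a small move of the last
    coordinate in either direction shifts the functional up or down, so an interior point attains
    neither bound. *)
Lemma interior_split_set :
  (split_set p ph p0 p1)° = [set z | p0 < dot p z.1 + ph * z.2 < p1].
Proof.
apply/seteqP; split=> [z|].
  case=> -[A B] [/= Az /nbhs_ballP[d /= d0 dB]] ABF.
  have bnd e : `|e| < d -> p0 <= dot p z.1 + ph * (z.2 + e) <= p1.
    move=> ed; apply: (ABF (z.1, z.2 + e)); split; first exact: nbhs_singleton.
    by apply: dB; rewrite /ball /= opprD addNKr normrN.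
  have d2 : 0 < d / 2 by rewrite divr_gt0.
  (* The sign factor makes the positive move raise the functional by |ph| d / 2 whatever the sign of
     [ph]. *)
  have sd : `|Num.sg ph * (d / 2)| < d.
    by rewrite normrM normr_sg hph mul1r gtr0_norm //; lra.
  have := bnd _ sd; have := bnd (- (Num.sg ph * (d / 2))).
  rewrite normrN => /(_ sd); rewrite !mulrDr mulrN !mulrA [ph * Num.sg ph]mulrC.
  rewrite -normrEsg.
  have : 0 < `|ph| * (d / 2) by rewrite mulr_gt0 // normr_gt0.
  by move=> ? /andP[? _] /andP[_ ?]; apply/andP; split; lra.
rewrite -open_subsetE => [z /andP[/ltW + /ltW]|].
  by rewrite /split_set /= => -> ->.
have -> : [set z : V | p0 < dot p z.1 + ph * z.2 < p1] =
    (fun z : V => dot p z.1 + ph * z.2 : R) @^-1`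
      ([set x | p0 < x] `&` [set x | x < p1]).
  by apply/seteqP; split=> z /= => [/andP[]|[-> ->]].
apply: open_comp; first by move=> z _; apply: split_continuous.
apply: openI; [exact: open_gt|exact: open_lt].
Qed.

End Split.

(** * Reduction of the split to a horizontal slab, and the cut coefficients *)

Section CompletedSquare.
Context {R : realType} {n : nat} (p : 'cV[R]_n) (ph p0 p1 : R).
Hypotheses (hph : ph != 0) (hp01 : p0 < p1).
Local Notation V := ('cV[R]_n * R^o)%type.

Definition split_center : 'cV[R]_n := (2 * ph)^-1 *: p.

(** The extreme value of the functional on the paraboloid, attained at x = -q: its minimum if [ph]
    is positive, its maximum if [ph] is negative. *)
Definition split_min : R := - norm2 p ^+ 2 / (4 * ph).

Definition split_height (s : R) : R := (s - split_min) / ph.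

Local Notation q := split_center.
Local Notation tau := split_height.

(** Dividing the functional by [ph] gives t + 2 q.x, and -[split_min] / [ph] is the missing
    |q|^2. *)
Lemma shear_height (z : V) : (shear q z).2 = tau (dot p z.1 + ph * z.2).
Proof.
rewrite /= /split_height /split_min /split_center !dot_linear norm2_sqr.
by field.
Qed.

Lemma split_height_min : tau split_min = 0.
Proof. by rewrite /split_height subrr mul0r. Qed.

Lemma split_height_le_pos : 0 < ph -> forall s t, (tau s <= tau t) = (s <= t).
Proof. by move=> ph0 s t; rewrite ler_pM2r ?invr_gt0 // lerD2r. Qed.

Lemma split_height_le_neg : ph < 0 -> forall s t, (tau s <= tau t) = (t <= s).
Proof. by move=> ph0 s t; rewrite ler_nM2r ?invr_lt0 // lerD2r. Qed.

Lemma paraboloid_split (z : V) :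
  (@paraboloid R n `\` (split_set p ph p0 p1)°) z <->
  paraboloid (shear q z) /\
    (dot p z.1 + ph * z.2 <= p0 \/ p1 <= dot p z.1 + ph * z.2).
Proof.
rewrite interior_split_set // -[paraboloid (shear q z)]/((shear q @^-1` _) z).
rewrite shear_paraboloid; split=> -[Pz sz]; split=> //.
  by move/negP: sz; rewrite negb_and -!leNgt => /orP.
by apply/negP; rewrite negb_and -!leNgt; apply/orP.
Qed.

Lemma paraboloid_hull_pos : 0 < ph ->
  paraboloid_hull p ph p0 p1 =
  shear q @^-1` convex_hull (outer (tau p0) (tau p1)).
Proof.
move=> ph0; rewrite -convex_hull_shear; congr convex_hull.
apply/seteqP; split=> z; rewrite paraboloid_split /= /outer /mkset shear_height
  !split_height_le_pos //.
Qed.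

(** For negative [ph] the map to heights reverses the order, so the ends of the slab are
    exchanged. *)
Lemma paraboloid_hull_neg : ph < 0 ->
  paraboloid_hull p ph p0 p1 =
  shear q @^-1` convex_hull (outer (tau p1) (tau p0)).
Proof.
move=> ph0; rewrite -convex_hull_shear; congr convex_hull.
apply/seteqP; split=> z; rewrite paraboloid_split /= /outer /mkset shear_height
  !split_height_le_neg // => -[? /or_comm ?]; split=> //.
Qed.

(** The components of x along p removed and restored cancel; what remains is b p / |p|^2, which is
    q. *)
Lemma proj_orth_add_center (x : 'cV[R]_n) :
  proj_orth p *m x + ((dot p x + cut_b p ph) / norm2 p ^+ 2) *: p = x + q.
Proof.
have -> : proj_orth p *m x = x - ((norm2 p ^+ 2)^-1 * dot p x) *: p.
  rewrite /proj_orth mulmxBl mul1mx -scalemxAl -mulmxA [p^T *m x]mx11_scalar.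
  by rewrite mul_mx_scalar scalerA.
rewrite /cut_b /split_center norm2_sqr.
(* For p = 0 every correction term, q included, is a multiple of p and vanishes whatever its
   coefficient. *)
have [/dot_eq0 ->|p_neq0] := eqVneq (dot p p) 0.
  by rewrite !scaler0 subr0.
rewrite -addrA -scaleNr -scalerDl; congr (_ + _ *: _).
by field; rewrite hph p_neq0.
Qed.

(** In terms of a and b the nested roots disappear: f = sqrt 2 ph (b - a) and c = 1 / (ph (a + b)).
    The right-hand side of the cut is then the chord at the sheared height, and the left-hand side
    is |x + q|. *)
Lemma cut_set_shear : 0 <= tau p0 -> 0 <= tau p1 ->
  let a := Num.sqrt (tau p0) in let b := Num.sqrt (tau p1) in
  cut_set p ph p0 p1 =
  shear q @^-1` [set w | norm2 w.1 <= (w.2 + a * b) / (a + b)].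
Proof.
move=> tau0 tau1 a b.
have sqrtE s : Num.sqrt (norm2 p ^+ 2 + 4 * s * ph) =
    2 * `|ph| * Num.sqrt (tau s).
  have -> : norm2 p ^+ 2 + 4 * s * ph = (2 * ph) ^+ 2 * tau s.
    by rewrite /split_height /split_min; field.
  by rewrite sqrtrM ?sqr_ge0 // sqrtr_sqr normrM ger0_norm.
have a0 : 0 <= a by apply: sqrtr_ge0.
have b0 : 0 <= b by apply: sqrtr_ge0.
have aE : a ^+ 2 = tau p0 by rewrite sqr_sqrtr.
have bE : b ^+ 2 = tau p1 by rewrite sqr_sqrtr.
have p0E : p0 = ph * a ^+ 2 + split_min.
  by rewrite aE /split_height; field.
have p1E : p1 = ph * b ^+ 2 + split_min.
  by rewrite bE /split_height; field.
have pd : p1 - p0 = ph * (b - a) * (b + a) by rewrite p0E p1E; ring.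
have ab0 : 0 < a + b.
  rewrite lt_neqAle addr_ge0 // andbT eq_sym; apply/eqP => s0.
  by move: hp01; rewrite -subr_gt0 pd (addrC b a) s0 mulr0 ltxx.
(* True for both signs of [ph]: if [ph] is negative then b < a. Hence the root defining f needs no
   absolute value. *)
have pba : 0 < ph * (b - a).
  by rewrite -(pmulr_lgt0 _ ab0) (addrC a b) -pd subr_gt0.
have sqrt2 : Num.sqrt 2 != 0 :> R by rewrite sqrtr_eq0 -ltNge.
have prodE : sqrt_prod p ph p0 p1 = 4 * ph ^+ 2 * (a * b).
  rewrite /sqrt_prod !sqrtE -/a -/b -real_normK ?num_real //; ring.
have fE : cut_f p ph p0 p1 = Num.sqrt 2 * (ph * (b - a)).
  rewrite /cut_f prodE.
  have -> : norm2 p ^+ 2 + 2 * (p0 + p1) * ph - 4 * ph ^+ 2 * (a * b) =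
      2 * (ph * (b - a)) ^+ 2.
    by rewrite p0E p1E /split_min; field.
  by rewrite sqrtrM // sqrtr_sqr gtr0_norm.
have ba0 : b - a != 0 by apply: contraTneq pba => ->; rewrite mulr0 ltxx.
have ab0' := lt0r_neq0 ab0.
have cE : cut_c p ph p0 p1 = (ph * (a + b))^-1.
  rewrite /cut_c fE pd; field.
  by rewrite ab0' hph ba0.
have eE : cut_e p ph p0 p1 = (a + b)^-1 * (a * b - split_min / ph).
  rewrite /cut_e fE pd prodE /split_min; field.
  by rewrite ab0' hph ba0.
apply/funext => z.
have cut_rhsE : cut_c p ph p0 p1 * dot p z.1 + cut_d p ph p0 p1 * z.2
    + cut_e p ph p0 p1 = ((shear q z).2 + a * b) / (a + b).
  rewrite shear_height /cut_d cE eE /split_height.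
  by field; rewrite ab0' hph.
by rewrite /cut_set /mkset proj_orth_add_center cut_rhsE.
Qed.

End CompletedSquare.

Theorem proposition4p2 (R : realType) (n : nat) (p : 'cV[R]_n) (ph p0 p1 : R)
  (hph : ph != 0) (hp01 : p0 < p1) :
  let Q0 := @paraboloid R n in
  let Q0bar := paraboloid_hull p ph p0 p1 in
  let m := - norm2 p ^+ 2 / (4 * ph) in
  [/\ (0 < ph /\ p1 <= m) \/ (ph < 0 /\ m <= p0) ->
        Q0bar = Q0,
      0 < ph -> p0 < m < p1 ->
        Q0bar = [set z | Q0 z /\ p1 <= dot p z.1 + ph * z.2],
      ph < 0 -> p0 < m < p1 ->
        Q0bar = [set z | Q0 z /\ dot p z.1 + ph * z.2 <= p0]
    & (0 < ph /\ m <= p0) \/ (ph < 0 /\ p1 <= m) ->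
        Q0bar = Q0 `&` cut_set p ph p0 p1].
Proof.
move=> Q0 Q0bar m; set tau := split_height p ph; set q := split_center p ph.
(* Since m has height 0, comparing [p0] and [p1] with m amounts to reading the signs of the slab
   heights. *)
have taum : tau m = 0 := split_height_min p ph.
have le_pos := split_height_le_pos p ph.
have le_neg := split_height_le_neg p ph.
have shearQ : shear q @^-1` Q0 = Q0 := shear_paraboloid q.
split.
- rewrite /Q0bar; case=> -[ph0 mp].
    by rewrite paraboloid_hull_pos // hull_outer_le0 // -taum le_pos.
  by rewrite paraboloid_hull_neg // hull_outer_le0 // -taum le_neg.
- move=> ph0 /andP[p0m _]; rewrite /Q0bar paraboloid_hull_pos //.
  rewrite hull_outer_straddle; last by rewrite -taum ltNge le_pos // -ltNge.
  rewrite -[in RHS]shearQ; apply/seteqP.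
  by split=> z; rewrite /preimage /mkset shear_height // le_pos.
- move=> ph0 /andP[_ p1m]; rewrite /Q0bar paraboloid_hull_neg //.
  rewrite hull_outer_straddle; last by rewrite -taum ltNge le_neg // -ltNge.
  rewrite -[in RHS]shearQ; apply/seteqP.
  by split=> z; rewrite /preimage /mkset shear_height // le_neg.
rewrite /Q0bar => mp.
have sq s : 0 <= tau s -> Num.sqrt (tau s) ^+ 2 = tau s by apply: sqr_sqrtr.
case: mp => -[ph0 mp].
  have t0 : 0 <= tau p0 by rewrite -taum le_pos.
  have t01 : tau p0 < tau p1 by rewrite ltNge le_pos // -ltNge.
  have t1 : 0 <= tau p1 := le_trans t0 (ltW t01).
  rewrite paraboloid_hull_pos // -/tau -(sq _ t0) -(sq _ t1).
  rewrite hull_outer_chord //.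
    by rewrite preimage_setI shearQ cut_set_shear // -/tau.
  by rewrite ltr_sqrt // (le_lt_trans t0).
have t1 : 0 <= tau p1 by rewrite -taum le_neg.
have t10 : tau p1 < tau p0 by rewrite ltNge le_neg // -ltNge.
have t0 : 0 <= tau p0 := le_trans t1 (ltW t10).
rewrite paraboloid_hull_neg // -/tau -(sq _ t0) -(sq _ t1).
rewrite hull_outer_chord //.
  (* The ends are exchanged here, but the chord formula is symmetric in a and b. *)
  by rewrite preimage_setI shearQ cut_set_shear // -/tau
    (addrC (Num.sqrt _)) (mulrC (Num.sqrt _)).
by rewrite ltr_sqrt // (le_lt_trans t1).
Qed.
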